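(* Let $K\ge1$ and let $E_0,\dots,E_K$ and $\Delta_0,\dots,\Delta_{K-1}$ be real numbers and $a_0,\dots,a_{K-1},b_0,\dots,b_{K-1}\ge0$. Suppose $$E_{k+1}\le a_kE_k+b_k\Delta_k,\qquad k=0,\dots,K-1.$$ With the convention that an empty product equals $1$, $$E_K\le\Bigl(\prod_{i=0}^{K-1}a_i\Bigr)E_0+\sum_{j=0}^{K-1}b_j\Bigl(\prod_{i=j+1}^{K-1}a_i\Bigr)\Delta_j.$$
   Context: No further notation is needed: in the paper $E_k$ is a residual/error budget and $\Delta_k$ a one-step increment. *)

(* Defs.v *)
From HB Require Import structures.
From mathcomp Require Export all_boot all_order all_algebra.
From mathcomp Require Export reals.

(* Main.v *)
Require Import Defs.
Import Order.TTheory GRing.Theory Num.Theory.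
Local Open Scope ring_scope.

(** Unroll the recursion by induction on [K]: since [a K >= 0], multiplying the bound for [E K] by
    [a K] preserves it and appends the factor [a K] to every product. *)

(* Finite families are total functions on nat of which only the indices in
   range (k <= K for E, k < K for a, b, Delta) are constrained or used. *)
Theorem lemma10p1 (R : realType) (K : nat) (E Delta a b : nat -> R)
    (hK : (1 <= K)%N)
    (ha : forall k : nat, (k < K)%N -> 0 <= a k)
    (hb : forall k : nat, (k < K)%N -> 0 <= b k)
    (hE : forall k : nat, (k < K)%N ->
       E k.+1 <= a k * E k + b k * Delta k) :
  E K <= (\prod_(0 <= i < K) a i) * E 0%N
         + \sum_(0 <= j < K) b j * (\prod_(j.+1 <= i < K) a i) * Delta j.
Proof.
elim: K ha hE {hK hb} => [|K IHK] ha hE; first by rewrite !big_nil mul1r addr0.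
have {}IHK : E K <= _ :=
  IHK (fun k lt_kK => ha k (ltnW lt_kK)) (fun k lt_kK => hE k (ltnW lt_kK)).
apply: le_trans (hE K (ltnSn K)) _.
(* The new summand [j = K] carries an empty product, so it is exactly [b K * Delta K] and
   cancels. *)
do 2!rewrite big_nat_recr //=; rewrite (big_geq (leqnn K.+1)) mulr1 addrA lerD2r.
apply: le_trans (ler_wpM2l (ha K (ltnSn K)) IHK) _.
rewrite mulrDr mulrCA mulrA mulr_sumr lerD2l ler_sum_nat // => j /andP[_ lt_jK].
(* As [j < K], the inner product is a nonempty range ending in [a K]; the summands agree up to
   commutativity. *)
by rewrite big_nat_recr //= mulrC -!mulrA (mulrC (Delta j)).
Qed.
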